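(* Let $W=\{(W_i,\omega_i)\}_{i\in I}$ be a fusion frame for a separable Hilbert space $\mathcal{H}$. For each $i\in I$ let $\{f_{i,j}\}_{j\in J_i}$ be a Riesz basis for $W_i$ with bounds $A_i\le B_i$, where $0<\inf_{i\in I}A_i\le\sup_{i\in I}B_i<\infty$, and let $\mathcal{F}=\{\omega_i f_{i,j}\}_{i\in I,\,j\in J_i}$ be the corresponding local frame of $W$. Then $e(W)=e(\mathcal{F})$.
   Context: All index sets are countable. A family $W=\{(W_i,\omega_i)\}_{i\in I}$ of closed subspaces $W_i\subseteq\mathcal{H}$ and weights $\omega_i>0$ is a fusion frame for $\mathcal{H}$ if there are $0<A\le B<\infty$ with $A\|f\|^2\le\sum_{i\in I}\omega_i^2\|\pi_{W_i}f\|^2\le B\|f\|^2$ for all $f\in\mathcal{H}$, where $\pi_{W_i}$ is the orthogonal projection onto $W_i$. $\bigoplus_{i\in I}W_i$ denotes the Hilbert space of sequences $\{f_i\}_{i\in I}$ with $f_i\in W_i$ and $\sum_i\|f_i\|^2<\infty$, with inner product $\langle\{f_i\},\{g_i\}\rangle=\sum_i\langle f_i,g_i\rangle$. The synthesis operator is $T_W:\bigoplus_{i\in I}W_i\to\mathcal{H}$, $T_W\{f_i\}=\sum_i\omega_i f_i$, and the excess of $W$ is $e(W)=\dim N(T_W)$, where $N$ denotes the null space; it is $\infty$ if the null space is infinite dimensional. If each $\{f_{i,j}\}_{j\in J_i}$ is a frame for $W_i$ with bounds $A_i,B_i$ satisfying $0<\inf A_i\le\sup B_i<\infty$, then $\{\omega_i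 f_{i,j}\}_{i\in I,j\in J_i}$ is a frame for $\mathcal{H}$, called a local frame of $W$. For an ordinary frame $\mathcal{F}=\{f_k\}_{k\in K}$, the excess $e(\mathcal{F})$ is the greatest integer $n$ such that $n$ elements can be removed from $\mathcal{F}$ leaving a complete set (or $\infty$ if there is no upper bound); equivalently $e(\mathcal{F})=\dim N(T_{\mathcal{F}})$, where $T_{\mathcal{F}}:\ell^2(K)\to\mathcal{H}$, $T_{\mathcal{F}}\{c_k\}=\sum_k c_kf_k$. *)

(* Defs.v *)
From HB Require Import structures.
From mathcomp Require Import all_boot all_order all_algebra finmap.
From mathcomp Require Import complex.
From mathcomp Require Import all_classical all_reals all_analysis.
From mathcomp.analysis.showcase Require summability.

Set Implicit Arguments.
Unset Strict Implicit.
Unset Printing Implicit Defensive.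

Import Order.TTheory GRing.Theory Num.Theory.
Import numFieldNormedType.Exports.

Local Open Scope classical_set_scope.
Local Open Scope ring_scope.

(* Hilbert spaces may be real or complex: the base field is R or R[i]. *)
Variant scalar_kind := RealScalars | ComplexScalars.

Definition base_field (R : realType) (k : scalar_kind) : numFieldType :=
  match k with RealScalars => R | ComplexScalars => R[i] end.

Definition conj_scalar (R : realType) (k : scalar_kind) :
    base_field R k -> base_field R k :=
  match k with RealScalars => idfun | ComplexScalars => @conjc R end.

Definition of_real (R : realType) (k : scalar_kind) : R -> base_field R k :=
  match k with RealScalars => idfun | ComplexScalars => fun x => x%:C%C end.

Definition re_scalar (R : realType) (k : scalar_kind) : base_field R k -> R :=
  match k with RealScalars => idfun | ComplexScalars => @complex.Re R end.

(* The library norm of a normed space over [base_field R k] takes its (nonnegative)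
   values in [base_field R k]; [rnorm] is the same norm with values in R. *)
Definition rnorm (R : realType) (k : scalar_kind)
  (V : normedZmodType (base_field R k)) (x : V) : R := re_scalar `|x|.

Section dimension.
Variables (R : realType) (K : fieldType) (U : lmodType K).

Definition lincomb (n : nat) (b : 'I_n -> U) (c : 'rV[K]_n) : U :=
  \sum_(i < n) c 0 i *: b i.

Definition is_basis (V : set U) (n : nat) (b : 'I_n -> U) : Prop :=
  injective (lincomb b) /\ range (lincomb b) = V.

(* +oo when the subspace V has no finite basis *)
Definition dimension (V : set U) : \bar R :=
  xget +oo%E [set n%:R%:E | n in [set n | exists b : 'I_n -> U, is_basis V b]].
End dimension.

Section Hilbert.
Variables (R : realType) (k : scalar_kind).
Local Notation K := (base_field R k).
Variables (H : completeNormedModType K) (ip : {dot H for @conj_scalar R k}).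

Definition separable_space : Prop := exists D : set H, countable D /\ dense D.

Definition closed_subspace (W : set H) : Prop :=
  closed W /\ submod_closed [pred x : H | x \in W].

Definition orth_proj (W : set H) (x : H) : H :=
  xget 0 [set y | W y /\ forall z, W z -> ip (x - y) z = 0].

Definition fusion_frame (I : countType) (W : I -> set H) (w : I -> R) : Prop :=
  [/\ forall i, closed_subspace (W i),
      forall i, 0 < w i
    & exists A B : R, [/\ 0 < A, A <= B & forall f : H,
        ((A * rnorm f ^+ 2)%:E <=
           \esum_(i in [set: I]) (w i ^+ 2 * rnorm (orth_proj (W i) f) ^+ 2)%:E
         <= (B * rnorm f ^+ 2)%:E)%E]].

Definition hilbert_sum (I : countType) (W : I -> set H) : set (I -> H) :=
  [set f | (forall i, W i (f i)) /\
           (\esum_(i in [set: I]) (rnorm (f i) ^+ 2)%:E < +oo)%E].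

(* [summability.sum] is the limit of the net of finite partial sums; it exists
   for every f in [hilbert_sum W] as soon as (W, w) is a fusion frame. *)
Definition fusion_synthesis (I : countType) (w : I -> R) (f : I -> H) : H :=
  summability.sum (fun i => of_real k (w i) *: f i).

Definition fusion_excess (I : countType) (W : I -> set H) (w : I -> R) :
    \bar R :=
  dimension R [set f : I -> H | hilbert_sum W f /\ fusion_synthesis w f = 0].

Definition span_family (J : choiceType) (D : set J) (f : J -> H) : set H :=
  [set x | exists (A : {fset J}) (c : J -> K),
     [set` A] `<=` D /\ x = \sum_(j <- A) c j *: f j].

(* greatest number of elements (counted by index) whose removal leaves a
   complete family; +oo if there is no upper bound *)
Definition frame_excess (J : choiceType) (f : J -> H) : \bar R :=
  ereal_sup [set n%:R%:E | n in [set n : nat | exists E : {fset J},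
    #|` E|%fset = n /\ closure (span_family (~` [set` E]) f) = [set: H]]].

Definition riesz_basis (J : choiceType) (W : set H) (f : J -> H) (a b : R) :
    Prop :=
  [/\ 0 < a, a <= b, closure (span_family [set: J] f) = W
    & forall (A : {fset J}) (c : J -> K),
        a * \sum_(j <- A) rnorm (c j) ^+ 2
          <= rnorm (\sum_(j <- A) c j *: f j) ^+ 2
          <= b * \sum_(j <- A) rnorm (c j) ^+ 2].

Definition local_frame (I : countType) (J : I -> countType) (w : I -> R)
    (f : forall i, J i -> H) : {i : I & J i} -> H :=
  fun ij => of_real k (w (tag ij)) *: f (tag ij) (tagged ij).
End Hilbert.

(* Main.v *)
Require Import Defs.
From mathcomp Require Import all_boot all_order all_algebra finmap complex.
From mathcomp Require Import all_classical all_reals all_analysis.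
From mathcomp.algebra_tactics Require Import ring lra.
From mathcomp.analysis.showcase Require summability.

Set Implicit Arguments.
Unset Strict Implicit.
Unset Printing Implicit Defensive.

Import Order.TTheory GRing.Theory Num.Theory.
Import numFieldNormedType.Exports.
Local Open Scope classical_set_scope.
Local Open Scope ring_scope.

(** Write F for the local frame, indexed by pairs e = (i, j), let V be the kernel
    of the synthesis operator T of the fusion frame, and for a family u with u i in
    W i let c_e(u) be the coefficient of u i on f i j in the Riesz basis of W i.

    The coordinates c_e separate the points of V, so the dimension of V is the
    supremum of the cardinals of the finite sets E for which (c_e), e in E, maps V
    onto K^E: a maximal such E is a coordinate system of V, and if there is none
    then V has no finite basis ([dimension_coords]). It remains to see that (c_e)
    maps V onto K^E exactly when F stays complete after removal of E.

    - If F without E is not complete, some h != 0 is orthogonal to all F e' with e'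
      outside E; since by the lower frame bound h is not orthogonal to every W i, it
      is not orthogonal to some F e with e in E. An element u of V with
      c_e(u) = 1 and c_e'(u) = 0 for the other e' in E would give
      0 = <T u, h> = <F e, h>, a contradiction ([complete_of_onto]).

    - If (c_e) is not onto K^E, finite linear algebra provides a nonzero linear
      form x on K^E vanishing on the image of V ([onto_coords_or_relation]). The
      form x o c vanishes on the kernel of the surjective operator T, hence factors
      as psi o T; psi is continuous because T has a bounded right inverse
      ([fusion_synthesis_preimage]), it vanishes on F e for e outside E, and it does
      not vanish on all of F. So F without E is not complete
      ([onto_of_complete]).

    The right inverse of T comes from the frame operator S = T T^*, which is bounded
    and coercive by the fusion frame bounds, hence bijective by the Lax-Milgram
    argument. The coordinates of a Riesz basis are the inner products with a
    biorthogonal family, and a vector is a limit of combinations of those basis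
    vectors on which its coordinate is nonzero ([riesz_expansion]). The case
    distinction between real and complex scalars is confined to the first part;
    the estimates are made on real numbers, most of them with the real part [rdot]
    of the inner product. *)

(** * Scalars *)

Section Scalars.
Variables (R : realType) (k : scalar_kind).
Local Notation K := (base_field R k).
Implicit Types (x y : R) (z t : K).

Lemma re_scalarD z t : re_scalar (z + t) = re_scalar z + re_scalar t.
Proof. by case: k z t => //= -[a b] [c d]. Qed.

Lemma re_scalarN z : re_scalar (- z) = - re_scalar z.
Proof. by case: k z => //= -[a b]. Qed.

Lemma re_scalar_of_realM x z : re_scalar (of_real k x * z) = x * re_scalar z.
Proof. by case: k z => //= -[a b] /=; rewrite mul0r subr0. Qed.

Lemma re_scalar_conj z : re_scalar (conj_scalar z) = re_scalar z.
Proof. by case: k z => //= -[a b]. Qed.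

Lemma re_scalar0 : re_scalar (0 : K) = 0.
Proof. by case: k. Qed.

Lemma conj_scalar0 : conj_scalar (0 : K) = 0.
Proof. by case: k => //=; rewrite oppr0. Qed.

Lemma of_realK x : re_scalar (of_real k x) = x.
Proof. by case: k. Qed.

Lemma conj_of_real x : conj_scalar (of_real k x) = of_real k x.
Proof. by case: k => //=; rewrite oppr0. Qed.

Lemma of_real_eq0 x : (of_real k x == 0) = (x == 0).
Proof. by case: k => //=; rewrite eq_complex /= eqxx andbT. Qed.

Lemma of_real0 : of_real k (0 : R) = 0.
Proof. by case: k. Qed.

Lemma of_real1 : of_real k (1 : R) = 1.
Proof. by case: k. Qed.

Lemma of_realM x y : of_real k (x * y) = of_real k x * of_real k y.
Proof. by case: k => //=; rewrite rmorphM. Qed.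

Lemma of_realD x y : of_real k (x + y) = of_real k x + of_real k y.
Proof. by case: k => //=; rewrite rmorphD. Qed.

Lemma ltr_of_real x y : (of_real k x < of_real k y) = (x < y).
Proof. by case: k => //=; rewrite ltcR. Qed.

Lemma ge0_of_real z : 0 <= z -> of_real k (re_scalar z) = z.
Proof.
by case: k z => //= -[a b]; rewrite lecE /= => /andP[/eqP -> _].
Qed.

Lemma norm_of_real x : `|of_real k x| = of_real k `|x|.
Proof. by case: k => //=; rewrite normc_def /= expr0n /= addr0 sqrtr_sqr. Qed.

Lemma re_scalar_conjM z : re_scalar (conj_scalar z * z) = (re_scalar `|z|) ^+ 2.
Proof.
case: k z => [z|[a b]] /=; first by rewrite real_normK ?num_real// expr2.
by rewrite sqr_sqrtr ?addr_ge0 ?sqr_ge0 //; ring.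
Qed.

End Scalars.

Section RealNorm.
Variables (R : realType) (k : scalar_kind).
Local Notation K := (base_field R k).
Variable V : normedModType K.
Implicit Types (u v w : V) (x : R).

Lemma of_real_rnorm u : of_real k (rnorm u) = `|u|.
Proof. exact: ge0_of_real. Qed.

Lemma rnorm_ge0 u : 0 <= rnorm u.
Proof.
have := normr_ge0 u; rewrite -of_real_rnorm /rnorm; move: (re_scalar _) => x.
by case: k => //=; rewrite lecR.
Qed.

Lemma rnorm0 : rnorm (0 : V) = 0.
Proof. by rewrite /rnorm normr0; case: k. Qed.

Lemma rnorm_eq0 u : (rnorm u == 0) = (u == 0).
Proof. by rewrite -(of_real_eq0 k) of_real_rnorm normr_eq0. Qed.

Lemma rnormN u : rnorm (- u) = rnorm u.
Proof. by rewrite /rnorm normrN. Qed.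

Lemma rnormB u v : rnorm (u - v) = rnorm (v - u).
Proof. by rewrite -rnormN opprB. Qed.

Lemma rnormD u v : rnorm (u + v) <= rnorm u + rnorm v.
Proof.
have := ler_normD u v; rewrite -!of_real_rnorm; move: (rnorm _) (rnorm _) (rnorm _).
by case: k => //= a b c; rewrite -rmorphD /= lecR.
Qed.

Lemma rnormZ (c : K) u : rnorm (c *: u) = rnorm c * rnorm u.
Proof.
rewrite {1}/rnorm normrZ -of_real_rnorm -(ge0_of_real (normr_ge0 c)).
by rewrite re_scalar_of_realM of_realK.
Qed.

Lemma rnorm_of_real x : rnorm (of_real k x) = `|x|.
Proof. by rewrite /rnorm norm_of_real of_realK. Qed.

Lemma nbhs_rnorm u (A : set V) :
  nbhs u A <-> exists2 e : R, 0 < e & forall v, rnorm (u - v) < e -> A v.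
Proof.
split.
  move=> /nbhs_normP[/= e e0 eA]; exists (re_scalar e).
    by rewrite -(ltr_of_real k) of_real0 ge0_of_real ?ltW.
  move=> v uv; apply: eA; rewrite /ball_ /= -of_real_rnorm.
  by rewrite -(ge0_of_real (ltW e0)) ltr_of_real.
move=> [e e0 eA]; apply/nbhs_normP; exists (of_real k e) => /=.
  by rewrite -(@of_real0 R k) ltr_of_real.
by move=> v; rewrite /ball_ /= -of_real_rnorm ltr_of_real => /eA.
Qed.

Lemma closure_rnorm (A : set V) u :
  closure A u <-> forall e : R, 0 < e -> exists2 v, A v & rnorm (u - v) < e.
Proof.
split=> [uA e e0|uA B /nbhs_rnorm[e e0 eB]].
  have [|v [Av /= uv]] := uA [set v | rnorm (u - v) < e]; last by exists v.
  by apply/nbhs_rnorm; exists e.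
by have [v Av uv] := uA _ e0; exists v; split => //; exact: eB.
Qed.

End RealNorm.

(** * Hilbert space geometry *)

Definition subspace (K : fieldType) (U : lmodType K) (V : set U) : Prop :=
  V 0 /\ forall c u v, V u -> V v -> V (c *: u + v).

Section Subspace.
Variables (K : fieldType) (U : lmodType K) (V : set U).
Hypothesis subV : subspace V.

Lemma subspaceD u v : V u -> V v -> V (u + v).
Proof. by move=> Vu Vv; rewrite -[u]scale1r; apply: subV.2. Qed.

Lemma subspaceZ c u : V u -> V (c *: u).
Proof. by move=> Vu; rewrite -[_ *: _]addr0; apply: subV.2 => //; exact: subV.1. Qed.

Lemma subspaceB u v : V u -> V v -> V (u - v).
Proof. by move=> Vu Vv; rewrite -scaleN1r addrC; apply: subV.2. Qed.

Lemma subspace_sum (T : eqType) (s : seq T) (F : T -> U) :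
  (forall i, i \in s -> V (F i)) -> V (\sum_(i <- s) F i).
Proof.
move=> VF; rewrite big_seq; elim/big_ind : _ => //; first exact: subV.1.
exact: subspaceD.
Qed.

End Subspace.

Section InnerProduct.
Variables (R : realType) (k : scalar_kind).
Local Notation K := (base_field R k).
Variables (H : completeNormedModType K) (ip : {dot H for @conj_scalar R k}).
Hypothesis ip_norm : forall x : H, ip x x = `|x| ^+ 2.
Implicit Types (x y z : H) (c : K) (r : R).

Lemma ipC x y : ip x y = conj_scalar (ip y x).
Proof. by rewrite hermitian_subproof expr0 mul1r. Qed.

Lemma ipDl x y z : ip (x + y) z = ip x z + ip y z.
Proof. exact: linearDl. Qed.

Lemma ipBl x y z : ip (x - y) z = ip x z - ip y z.
Proof. exact: linearBl. Qed.

Lemma ipZl c x z : ip (c *: x) z = c * ip x z.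
Proof. exact: linearZl_LR. Qed.

Lemma ip0l z : ip 0 z = 0.
Proof. exact: linear0l. Qed.

Lemma ipZr c x z : ip x (c *: z) = conj_scalar c * ip x z.
Proof. exact: linearZr_LR. Qed.

Lemma ip_suml (T : Type) (s : seq T) (F : T -> H) z :
  ip (\sum_(i <- s) F i) z = \sum_(i <- s) ip (F i) z.
Proof. exact: linear_sumlz. Qed.

Definition rdot x y : R := re_scalar (ip x y).

Lemma rdotC x y : rdot x y = rdot y x.
Proof. by rewrite /rdot ipC re_scalar_conj. Qed.

Lemma rdotDl x y z : rdot (x + y) z = rdot x z + rdot y z.
Proof. by rewrite /rdot ipDl re_scalarD. Qed.

Lemma rdotDr x y z : rdot x (y + z) = rdot x y + rdot x z.
Proof. by rewrite !(rdotC x) rdotDl. Qed.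

Lemma rdotBl x y z : rdot (x - y) z = rdot x z - rdot y z.
Proof. by rewrite /rdot ipBl re_scalarD re_scalarN. Qed.

Lemma rdotBr x y z : rdot x (y - z) = rdot x y - rdot x z.
Proof. by rewrite !(rdotC x) rdotBl. Qed.

Lemma rdotZl r x z : rdot (of_real k r *: x) z = r * rdot x z.
Proof. by rewrite /rdot ipZl re_scalar_of_realM. Qed.

Lemma rdotZr r x z : rdot x (of_real k r *: z) = r * rdot x z.
Proof. by rewrite !(rdotC x) rdotZl. Qed.

Lemma rdot_suml (T : Type) (s : seq T) (F : T -> H) z :
  rdot (\sum_(i <- s) F i) z = \sum_(i <- s) rdot (F i) z.
Proof.
elim: s => [|i s IHs]; last by rewrite !big_cons rdotDl IHs.
by rewrite !big_nil /rdot ip0l re_scalar0.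
Qed.

Lemma rdotE x : rdot x x = rnorm x ^+ 2.
Proof. by rewrite /rdot ip_norm -of_real_rnorm !expr2 re_scalar_of_realM of_realK. Qed.

Lemma rnorm_sqrD x y : rnorm (x + y) ^+ 2 = rnorm x ^+ 2 + 2 * rdot x y + rnorm y ^+ 2.
Proof. by rewrite -!rdotE rdotDl !rdotDr (rdotC y x); ring. Qed.

Lemma rnorm_sqrB x y : rnorm (x - y) ^+ 2 = rnorm x ^+ 2 - 2 * rdot x y + rnorm y ^+ 2.
Proof. by rewrite -!rdotE rdotBl !rdotBr (rdotC y x); ring. Qed.

(** The Cauchy-Schwarz inequality for the real part is the triangle inequality
    squared. *)
Lemma rdot_le x y : rdot x y <= rnorm x * rnorm y.
Proof.
have := rnormD x y; rewrite -(@ler_pXn2r _ 2) ?nnegrE ?addr_ge0 ?rnorm_ge0//.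
by rewrite rnorm_sqrD; nra.
Qed.

(** Multiplying the second argument by [ip x y] makes the product real. *)
Lemma rdot_phase x y : rdot x (ip x y *: y) = rnorm (ip x y) ^+ 2.
Proof. by rewrite /rdot ipZr re_scalar_conjM. Qed.

Lemma cauchy_schwarz x y : rnorm (ip x y) <= rnorm x * rnorm y.
Proof.
have := rdot_le x (ip x y *: y); rewrite rdot_phase rnormZ.
have : 0 <= rnorm (ip x y) := rnorm_ge0 _.
rewrite le_eqVlt => /predU1P[<- _|p0]; first by rewrite mulr_ge0 ?rnorm_ge0.
by rewrite expr2 mulrCA ler_pM2l.
Qed.

(** Cantor's intersection theorem for a family of sets shrinking with its
    radius; it replaces the choice of Cauchy sequences. *)
Lemma shrinking_limit (D : R -> set H) :
    (forall d, 0 < d -> D d !=set0) ->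
    (forall d e, d <= e -> D d `<=` D e) ->
    (forall e, 0 < e -> exists2 d, 0 < d &
       forall x y, D d x -> D d y -> rnorm (x - y) < e) ->
  exists l, forall e, 0 < e -> exists2 d, 0 < d &
    forall x, D d x -> rnorm (x - l) < e.
Proof.
move=> D0 Dle Dsmall; pose F := filter_from [set d : R | 0 < d] D.
have FF : ProperFilter F.
  apply: filter_from_proper; last exact: D0.
  apply: filter_from_filter; first by exists 1; rewrite /= ltr01.
  move=> d e /= d0 e0; exists (Num.min d e); first by rewrite /= lt_min d0.
  by move=> x Dx; split; apply: (Dle _ _ _ x Dx); rewrite ge_min lexx ?orbT.
have /cauchy_cvgP Fcvg : cauchy F.
  apply: cauchy_exP => eps eps0.
  have e0 : 0 < re_scalar eps.
    by rewrite -(ltr_of_real k) of_real0 ge0_of_real ?ltW.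
  have [d d0 Dd] := Dsmall _ e0; have [x Dx] := D0 _ d0.
  exists x; exists d => // y Dy; rewrite -ball_normE /ball_ /=.
  by rewrite -of_real_rnorm -(ge0_of_real (ltW eps0)) ltr_of_real Dd.
exists (lim F) => e e0.
have [|d d0 Dd] := Fcvg [set x | rnorm (x - lim F) < e].
  by apply/nbhs_rnorm; exists e => // v; rewrite /= rnormB.
by exists d.
Qed.

(** The first variation of the distance along [z] vanishes; the step [t] below
    makes the quadratic polynomial in [t] negative unless [rdot u z = 0]. *)
Lemma nearest_orthogonal (M : set H) u : subspace M ->
  (forall z, M z -> rnorm u <= rnorm (u - z)) -> forall z, M z -> ip u z = 0.
Proof.
move=> subM umin.
suff real_orth z : M z -> rdot u z = 0.
  move=> z Mz; have := real_orth _ (subspaceZ subM (ip u z) Mz).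
  by rewrite rdot_phase => /eqP; rewrite sqrf_eq0 rnorm_eq0 => /eqP.
move=> Mz; set p := rdot u z; set N := rnorm z ^+ 2.
have N0 : 0 <= N by exact: sqr_ge0.
have N1 : N + 1 != 0 by rewrite gt_eqF// ltr_wpDl.
pose t := p / (N + 1); have tE : p = t * (N + 1) by rewrite /t divfK.
have := umin _ (subspaceZ subM (of_real k t) Mz).
rewrite -(@ler_pXn2r _ 2) ?nnegrE ?rnorm_ge0// rnorm_sqrB rdotZr.
rewrite -/p rnormZ exprMn rnorm_of_real real_normK ?num_real// -/N => h.
have t2 : t ^+ 2 * (N + 2) <= 0 by move: h; rewrite tE; nra.
have /eqP t0 : t == 0.
  rewrite -(sqrf_eq0 t) eq_le sqr_ge0 andbT -(@pmulr_lle0 _ (N + 2)) ?ltr_wpDl//.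
by rewrite tE t0 mul0r.
Qed.

(** Hilbert's projection theorem: the elements of [M] whose squared distance to
    [x] is within [d] of the infimum shrink to a point, by the parallelogram
    identity. *)
Theorem orthogonal_decomposition (M : set H) x : closed M -> subspace M ->
  exists2 y, M y & forall z, M z -> ip (x - y) z = 0.
Proof.
move=> clM subM; pose S := [set rnorm (x - m) ^+ 2 | m in M].
have S0 : has_inf S.
  split; first by exists (rnorm (x - 0) ^+ 2); exists 0 => //; exact: subM.1.
  by exists 0 => _ [m _ <-]; exact: sqr_ge0.
pose D e := [set m | M m /\ rnorm (x - m) ^+ 2 < inf S + e].
have infS m : M m -> inf S <= rnorm (x - m) ^+ 2.
  by move=> Mm; apply: ge_inf; [exact: S0.2|exists m].
have [l Dl] : exists l, forall e, 0 < e -> exists2 d, 0 < d &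
    forall m, D d m -> rnorm (m - l) < e.
  apply: shrinking_limit => [d d0|d e de m [Mm dm]|e e0].
  - by have [_ [m Mm <-] ?] := inf_adherent d0 S0; exists m.
  - by split=> //; apply: (lt_le_trans dm); rewrite lerD2l.
  - exists (e ^+ 2 / 8); first by rewrite divr_gt0 ?exprn_gt0.
    move=> m m' [Mm dm] [Mm' dm'].
    (* parallelogram identity, the midpoint of m and m' lying in M *)
    pose n := of_real k 2^-1 *: (m + m').
    have Mn : M n by apply: subspaceZ => //; exact: subspaceD.
    have nE : rnorm ((x - m) + (x - m')) = 2 * rnorm (x - n).
      rewrite -[2 in RHS]ger0_norm// -(rnorm_of_real k) -rnormZ scalerBr scalerA.
      rewrite -of_realM divff// of_real1.
      rewrite scale1r (natrD R 1 1) of_realD of_real1.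
      by rewrite scalerDl scale1r addrACA opprD.
    have := rnorm_sqrB (x - m) (x - m').
    have := rnorm_sqrD (x - m) (x - m').
    rewrite nE (_ : x - m - (x - m') = m' - m); last first.
      by rewrite opprB addrC addrA subrK.
    have := infS _ Mn; rewrite (rnormB m) => h1 h2 h3.
    by rewrite -(@ltr_pXn2r _ 2) ?nnegrE ?rnorm_ge0 ?(ltW e0)//; nra.
have Ml : M l.
  rewrite ((closure_id M).1 clM); apply/closure_rnorm => e e0.
  have [d d0 Dd] := Dl _ e0; have [_ [m Mm <-] dm] := inf_adherent d0 S0.
  by exists m => //; rewrite rnormB Dd.
exists l => //; apply: nearest_orthogonal => // z Mz.
set s := rnorm (x - l - z).
have sS : inf S <= s ^+ 2.
  by rewrite /s -addrA -opprD; apply: infS; exact: subspaceD.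
apply/ler_addgt0Pr => e e0; pose r := e / 2.
have r0 : 0 < r by rewrite divr_gt0.
have [d d0 Dd] := Dl _ r0.
have [|_ [m Mm <-] dm] := @inf_adherent _ S (Num.min d (r ^+ 2)) _ S0.
  by rewrite lt_min d0 exprn_gt0.
have ml : rnorm (m - l) < r.
  by apply: Dd; split=> //; apply: (lt_le_trans dm); rewrite lerD2l ge_min lexx.
have xm : rnorm (x - m) < s + r.
  have s0 : 0 <= s by exact: rnorm_ge0.
  rewrite -(@ltr_pXn2r _ 2) ?nnegrE ?rnorm_ge0 ?addr_ge0 ?(ltW r0)//.
  have : rnorm (x - m) ^+ 2 < inf S + r ^+ 2.
    by apply: (lt_le_trans dm); rewrite lerD2l ge_min lexx orbT.
  by nra.
have h : rnorm (x - l) <= rnorm (x - m) + rnorm (m - l).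
  by apply: le_trans (rnormD _ _); rewrite addrA subrK.
by apply: (le_trans h); rewrite (splitr e) -/r; lra.
Qed.

End InnerProduct.

(** * Closed spans and projections *)

Section Closure.
Variables (R : realType) (k : scalar_kind).
Local Notation K := (base_field R k).
Variables (H : completeNormedModType K) (ip : {dot H for @conj_scalar R k}).
Hypothesis ip_norm : forall x : H, ip x x = `|x| ^+ 2.
Implicit Types (x y z h : H) (c : K).

Lemma closure_subspace (V : set H) : subspace V -> subspace (closure V).
Proof.
move=> subV; split=> [|c u v /closure_rnorm uV /closure_rnorm vV].
  by apply: subset_closure; exact: subV.1.
apply/closure_rnorm => e e0.
have c1 : 0 < rnorm c + 1 by rewrite ltr_wpDl ?rnorm_ge0.
have [|u' Vu' uu'] := uV (e / 2 / (rnorm c + 1)); first by rewrite !divr_gt0.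
have [|v' Vv' vv'] := vV (e / 2); first by rewrite divr_gt0.
exists (c *: u' + v'); first exact: subV.2.
rewrite opprD addrACA -scalerBr (le_lt_trans (rnormD _ _))// rnormZ.
rewrite ltr_pdivlMr// in uu'.
by have := rnorm_ge0 (u - u'); have := rnorm_ge0 c; nra.
Qed.

(** A bound on [F x - F y] for all [x] and [y] bounds the absolute value as well,
    by exchanging [x] and [y]. *)
Lemma rnorm_continuous (F : H -> R) (C : R) :
  (forall x y, F x - F y <= C * rnorm (x - y)) -> continuous F.
Proof.
move=> FC x; apply/cvgrPdist_le => e e0.
have C1 : 0 < `|C| + 1 by rewrite ltr_wpDl.
apply/nbhs_rnorm; exists (e / (`|C| + 1)); first by rewrite divr_gt0.
move=> y; rewrite ltr_pdivlMr// => xy.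
have := ler_norm C; have := rnorm_ge0 (x - y).
by rewrite ler_norml; have := FC x y; have := FC y x; rewrite (rnormB y); nra.
Qed.

Lemma continuous_rnorm : continuous (fun x : H => rnorm x).
Proof.
apply: (@rnorm_continuous _ 1) => x y.
by rewrite mul1r lerBlDr -{1}(subrK y x) rnormD.
Qed.

Lemma continuous_rnorm_ip h : continuous (fun x => rnorm (ip x h)).
Proof.
apply: (@rnorm_continuous _ (rnorm h)) => x y.
rewrite mulrC; apply: le_trans (cauchy_schwarz ip_norm _ _).
by rewrite lerBlDr ipBl -{1}(subrK (ip y h) (ip x h)) (@rnormD _ _ K).
Qed.

Lemma closure_le0 (A : set H) (F : H -> R) : continuous F ->
  (forall x, A x -> F x <= 0) -> forall x, closure A x -> F x <= 0.
Proof.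
move=> cF AF x; suff : closure A `<=` [set y | F y <= 0] by apply.
have clF : closed [set y | F y <= 0].
  exact: (closed_comp (fun y _ => cF y) (@closed_le R 0)).
by rewrite [X in _ `<=` X](closure_id _).1//; apply: closure_subset.
Qed.

Lemma closure_orthogonal (A : set H) h : (forall x, A x -> ip x h = 0) ->
  forall x, closure A x -> ip x h = 0.
Proof.
move=> Ah x Ax; apply/eqP; rewrite -(@rnorm_eq0 R k K) eq_le rnorm_ge0 andbT.
apply: (closure_le0 (@continuous_rnorm_ip h) _ Ax) => y /Ah ->.
by rewrite (@rnorm0 R k K).
Qed.

Lemma orthogonal_of_not_dense (V : set H) : subspace V -> closure V <> setT ->
  exists2 h, h != 0 & forall x, V x -> ip x h = 0.
Proof.
move=> subV VT; have [x Vx] : exists x, ~ closure V x.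
  by apply/existsNP => VT'; apply: VT; apply/seteqP; split=> // x _; exact: VT'.
have [y Vy oxy] := orthogonal_decomposition ip_norm x
  (@closed_closure _ V) (closure_subspace subV).
exists (x - y); first by apply/eqP => /subr0_eq xy; apply: Vx; rewrite xy.
by move=> z Vz; rewrite ipC oxy ?conj_scalar0//; exact: subset_closure.
Qed.

Section Span.
Variables (J : choiceType) (f : J -> H).
Implicit Types D : set J.

Lemma span_family_mem D j : D j -> span_family D f (f j).
Proof.
move=> Dj; exists [fset j]%fset, (fun _ => 1); split.
  by move=> i /=; rewrite inE => /eqP ->.
by rewrite big_seq_fset1 scale1r.
Qed.

Lemma widen_lincomb (A B : {fset J}) (c : J -> K) : (A `<=` B)%fset ->
  \sum_(j <- A) c j *: f j = \sum_(j <- B) (if j \in A then c j else 0) *: f j.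
Proof.
move=> AB; rewrite -(big_fset_incl _ AB).
  by apply: eq_big_seq => j ->.
by move=> j _ /negPf ->; rewrite scale0r.
Qed.

Lemma span_subspace D : subspace (span_family D f).
Proof.
split.
  by exists fset0, (fun _ => 0); split; [move=> j|rewrite big_seq_fset0].
move=> c _ _ [A [u [AD ->]]] [B [v [BD ->]]].
exists (A `|` B)%fset.
exists (fun j => c * (if j \in A then u j else 0) + (if j \in B then v j else 0)).
split.
  by move=> j /=; rewrite inE => /orP[jA|jB]; [exact: AD|exact: BD].
rewrite (widen_lincomb _ (fsubsetUl A B)) (widen_lincomb _ (fsubsetUr A B)).
rewrite scaler_sumr -big_split; apply: eq_bigr => j _.
by rewrite scalerA scalerDl.
Qed.

Lemma span_orthogonal D h : (forall j, D j -> ip (f j) h = 0) ->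
  forall x, span_family D f x -> ip x h = 0.
Proof.
move=> Dh _ [A [c [AD ->]]]; rewrite ip_suml big_seq big1// => j jA.
by rewrite ipZl Dh ?mulr0//; exact: AD.
Qed.

End Span.

Section OrthProj.
Variable W : set H.
Hypothesis clW : closed_subspace W.

Lemma closed_subspaceP : closed W /\ subspace W.
Proof.
case: clW => ? [W0 WZ]; split=> //; split; first exact: (set_mem W0).
by move=> c u v Wu Wv; apply: set_mem; apply: WZ; exact: mem_set.
Qed.

Local Notation P := (orth_proj ip W).

Lemma orth_projP x : W (P x) /\ forall z, W z -> ip (x - P x) z = 0.
Proof.
have [clo sub] := closed_subspaceP.
have [y Wy xy] := orthogonal_decomposition ip_norm x clo sub.
by apply: (@xgetPex _ 0 [set y | W y /\ forall z, W z -> ip (x - y) z = 0]); exists y.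
Qed.

Lemma orth_proj_unique x y : W y -> (forall z, W z -> ip (x - y) z = 0) -> P x = y.
Proof.
move=> Wy xy; have [Wp xp] := orth_projP x; have [_ sub] := closed_subspaceP.
apply/eqP; rewrite -subr_eq0 -rnorm_eq0 -sqrf_eq0 -(rdotE ip_norm) /rdot.
set z := P x - y; have Wz : W z by exact: subspaceB.
rewrite {1}/z (_ : P x - y = (x - y) - (x - P x)); last first.
  by rewrite opprB [RHS]addrC addrA subrK.
by rewrite ipBl xy// xp// subrr re_scalar0.
Qed.

Lemma orth_proj_linear c x y : P (c *: x + y) = c *: P x + P y.
Proof.
have [_ sub] := closed_subspaceP.
have [Wx ox] := orth_projP x; have [Wy oy] := orth_projP y.
apply: orth_proj_unique => [|z Wz]; first exact: sub.2.
by rewrite opprD addrACA -scalerBr ipDl ipZl ox// oy// mulr0 addr0.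
Qed.

Lemma rdot_orth_proj x z : W z -> rdot ip z x = rdot ip z (P x).
Proof.
move=> Wz; apply/eqP; rewrite -subr_eq0 -rdotBr rdotC /rdot.
by rewrite (orth_projP x).2// re_scalar0.
Qed.

Lemma rdot_orth_proj_self x : rdot ip (P x) x = rnorm (P x) ^+ 2.
Proof. by rewrite (rdot_orth_proj _ (orth_projP x).1) rdotE. Qed.

Lemma rnorm_orth_proj x : rnorm (P x) <= rnorm x.
Proof.
have := rdot_le ip_norm (P x) x; rewrite rdot_orth_proj_self => h.
have x0 := rnorm_ge0 x; rewrite leNgt; apply/negP => px.
by move: h; apply/negP; rewrite -ltNge expr2 ltr_pM2l// (le_lt_trans x0).
Qed.

Lemma orth_proj0 x : (forall z, W z -> ip z x = 0) -> P x = 0.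
Proof.
move=> ox; apply: orth_proj_unique; first exact: closed_subspaceP.2.1.
by move=> z Wz; rewrite subr0 ipC ox// conj_scalar0.
Qed.

End OrthProj.
End Closure.

(** * Unconditional sums and the frame operator *)

Section FiniteSums.
Variables (R : realType) (I : choiceType).

Lemma big_fset_sub (V : nmodType) (F : I -> V) (A B : {fset I}) : (A `<=` B)%fset ->
  \sum_(i <- B) F i = \sum_(i <- A) F i + \sum_(i <- (B `\` A)%fset) F i.
Proof.
move=> AB; rewrite (big_fsetID _ (mem A)) /=; congr (_ + _); apply: eq_fbigl => i.
  by rewrite !inE /= andbC; case: (boolP (i \in A)) => // /(fsubsetP AB) ->.
by rewrite !inE andbC.
Qed.

Variable g : I -> R.
Hypothesis g0 : forall i, 0 <= g i.

Lemma fset_sum_ge0 (A : {fset I}) : 0 <= \sum_(i <- A) g i.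
Proof. exact: sumr_ge0. Qed.

Lemma fset_sumS (A B : {fset I}) : (A `<=` B)%fset ->
  \sum_(i <- A) g i <= \sum_(i <- B) g i.
Proof. by move=> AB; rewrite (big_fset_sub _ AB) lerDl fset_sum_ge0. Qed.

Lemma esum_leP (M : R) :
  (\esum_(i in [set: I]) (g i)%:E <= M%:E)%E <->
  forall A : {fset I}, \sum_(i <- A) g i <= M.
Proof.
have fsumE (A : {fset I}) :
    (\sum_(i \in [set` A]) (g i)%:E = (\sum_(i <- A) g i)%:E)%E.
  by rewrite -fsbig_seq ?fset_uniq// sumEFin.
split=> [gM A|gM].
  rewrite -lee_fin; apply: le_trans gM; apply: esum_ge; exists [set` A].
    by split=> //; exact: finite_fset.
  by rewrite fsumE.
apply: ge_ereal_sup => _ [X [/finite_fsetP[A ->] _] <-].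
by rewrite fsumE lee_fin.
Qed.

Lemma esum_adherent (x e : R) : 0 < e ->
  (x%:E <= \esum_(i in [set: I]) (g i)%:E)%E ->
  exists A : {fset I}, x - e < \sum_(i <- A) g i.
Proof.
move=> e0 xg; apply: contrapT => /forallNP h.
have : (\esum_(i in [set: I]) (g i)%:E <= (x - e)%:E)%E.
  by apply/esum_leP => A; rewrite leNgt; apply/negP/h.
by move/(le_trans xg); rewrite lee_fin; lra.
Qed.

Lemma esum_lty : (\esum_(i in [set: I]) (g i)%:E < +oo)%E <->
  exists M, forall A : {fset I}, \sum_(i <- A) g i <= M.
Proof.
split=> [goo|[M gM]]; last by apply: le_lt_trans (ltry M); exact/esum_leP.
have : \esum_(i in [set: I]) (g i)%:E \is a fin_num.
  by rewrite ge0_fin_numE// esum_ge0// => i _; rewrite lee_fin.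
move=> /fineK gE; exists (fine (\esum_(i in [set: I]) (g i)%:E)).
by apply/esum_leP; rewrite gE.
Qed.

End FiniteSums.

Section Sums.
Variables (R : realType) (k : scalar_kind).
Local Notation K := (base_field R k).
Variables (H : completeNormedModType K).
Variable I : choiceType.
Implicit Types (x y : I -> H) (l m : H) (c : K).

(** Unconditional convergence, in terms of real numbers: the net of partial sums
    over finite sets tends to [l]. *)
Definition sums_to x l : Prop := forall e : R, 0 < e ->
  exists A0 : {fset I}, forall A : {fset I}, (A0 `<=` A)%fset ->
    rnorm (\sum_(i <- A) x i - l) < e.

Lemma sums_toE x l : sums_to x l -> summability.sum x = l.
Proof.
move=> xl; apply: cvg_lim; first exact: norm_hausdorff.
  exact: summability.totally_filter.
move=> B /nbhs_rnorm[e e0 eB]; have [A0 A0P] := xl _ e0.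
exists A0 => // A /= A0A; apply: eB; rewrite rnormB.
rewrite /summability.partial_sum.
by have := A0P _ A0A; rewrite big_seq_fsetE.
Qed.

Lemma sums_to_bound x l (C : R) : (forall A : {fset I}, rnorm (\sum_(i <- A) x i) <= C) ->
  sums_to x l -> rnorm l <= C.
Proof.
move=> xC xl; apply/ler_addgt0Pr => e /xl[A0 /(_ _ (fsubset_refl A0))].
have h : rnorm l <= rnorm (\sum_(i <- A0) x i) + rnorm (\sum_(i <- A0) x i - l).
  by rewrite (rnormB _ l); apply: le_trans (rnormD _ _); rewrite addrC subrK.
by have := xC A0; lra.
Qed.

Lemma sums_to_linear c x y l m : sums_to x l -> sums_to y m ->
  sums_to (fun i => c *: x i + y i) (c *: l + m).
Proof.
move=> xl ym e e0.
have c1 : 0 < rnorm c + 1 by rewrite ltr_wpDl ?rnorm_ge0.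
have [|A1 A1P] := xl (e / 2 / (rnorm c + 1)); first by rewrite !divr_gt0.
have [|A2 A2P] := ym (e / 2); first by rewrite divr_gt0.
exists (A1 `|` A2)%fset => A; rewrite fsubUset => /andP[/A1P A1A /A2P A2A].
rewrite big_split -scaler_sumr /= opprD addrACA -scalerBr.
rewrite (le_lt_trans (rnormD _ _))// rnormZ.
rewrite ltr_pdivlMr// in A1A; move: A1A A2A; set u := rnorm (_ - l).
have : 0 <= u by exact: rnorm_ge0.
by have := rnorm_ge0 c; nra.
Qed.

(** The near-maximal finite subsums of [g] give a shrinking family of partial
    sums of [x], since passing from one to another costs a small part of [g]. *)
Lemma sums_to_exists x (g : I -> R) (C M : R) : (forall i, 0 <= g i) -> 0 <= C ->
    (forall A : {fset I}, \sum_(i <- A) g i <= M) ->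
    (forall A : {fset I}, rnorm (\sum_(i <- A) x i) ^+ 2 <= C * \sum_(i <- A) g i) ->
  exists l, sums_to x l.
Proof.
move=> g0 C0 gM xg; pose S := [set \sum_(i <- A) g i | A in [set: {fset I}]].
have S0 : has_sup S.
  by split; [exists (\sum_(i <- fset0) g i), fset0|exists M => _ [A _ <-]].
pose big d := [set A : {fset I} | sup S - d < \sum_(i <- A) g i].
have gS (A : {fset I}) : \sum_(i <- A) g i <= sup S.
  by apply: ub_le_sup; [exact: S0.2|exists A].
have bigS d (A B : {fset I}) : (A `<=` B)%fset -> big d A -> big d B.
  by move=> AB /= dA; apply: lt_le_trans dA (fset_sumS g0 AB).
have big_diff d (A B : {fset I}) : (A `<=` B)%fset -> big d A ->
    rnorm (\sum_(i <- B) x i - \sum_(i <- A) x i) ^+ 2 <= C * d.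
  rewrite /big /= => AB dA; rewrite (big_fset_sub x AB) addrC addKr.
  apply: (le_trans (xg _)); apply: ler_wpM2l => //.
  by have := gS B; rewrite (big_fset_sub g AB); lra.
have [l Dl] : exists l, forall e, 0 < e -> exists2 d, 0 < d &
    forall z, [set \sum_(i <- A) x i | A in big d] z -> rnorm (z - l) < e.
  apply: shrinking_limit => [d d0|d e de _ [A dA <-]|e e0].
  - have [_ [A _ <-] dA] := sup_adherent d0 S0.
    by exists (\sum_(i <- A) x i), A.
  - by exists A => //; move: dA; rewrite /big /=; lra.
  have C1 : 0 < C + 1 by rewrite ltr_wpDl.
  pose d := e ^+ 2 / 9 / (C + 1).
  have dE : (C + 1) * d = e ^+ 2 / 9 by rewrite /d mulrC divfK ?gt_eqF.
  have d0 : 0 < d by rewrite !divr_gt0 ?exprn_gt0.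
  exists d => // _ _ [A dA <-] [B dB <-].
  have small (z : H) : rnorm z ^+ 2 <= C * d -> rnorm z < e / 2.
    by move=> zd; rewrite -(@ltr_pXn2r _ 2) ?nnegrE ?rnorm_ge0 ?divr_ge0 ?(ltW e0)//; nra.
  have /small hA := big_diff _ _ _ (fsubsetUl A B) dA.
  have /small hB := big_diff _ _ _ (fsubsetUr A B) dB.
  rewrite rnormB in hA; rewrite (splitr e); apply: le_lt_trans (ltrD hA hB).
  by apply: le_trans (rnormD _ _); rewrite addrA subrK.
exists l => e e0; have [d d0 Dd] := Dl _ e0.
have [_ [A0 _ <-] dA] := sup_adherent d0 S0.
by exists A0 => A A0A; apply: Dd; exists A => //; exact: bigS dA.
Qed.

End Sums.

Section FrameOperator.
Variables (R : realType) (k : scalar_kind).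
Local Notation K := (base_field R k).
Variables (H : completeNormedModType K) (ip : {dot H for @conj_scalar R k}).
Hypothesis ip_norm : forall x : H, ip x x = `|x| ^+ 2.
Variables (I : countType) (W : I -> set H) (w : I -> R).
Hypothesis clW : forall i, closed_subspace (W i).
Implicit Types (x y z : H).

Local Notation P i := (orth_proj ip (W i)).
Local Notation subW i := (closed_subspaceP (clW i)).2.

Lemma hilbert_sumP (f : I -> H) : hilbert_sum W f <->
  (forall i, W i (f i)) /\
  exists M : R, forall A : {fset I}, \sum_(i <- A) rnorm (f i) ^+ 2 <= M.
Proof.
by rewrite /hilbert_sum /=; split=> -[Wf fM]; split=> //;
  apply/(esum_lty (fun i => sqr_ge0 (rnorm (f i)))).
Qed.

Lemma hilbert_sum_subspace : subspace (hilbert_sum W).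
Proof.
split.
  apply/hilbert_sumP; split=> [i|]; first exact: (subW i).1.
  by exists 0 => A; rewrite big1// => i _; rewrite rnorm0 expr0n.
move=> c u v /hilbert_sumP[Wu [M uM]] /hilbert_sumP[Wv [N vN]].
apply/hilbert_sumP; split=> [i|]; first exact: (subW i).2.
(* rnorm (x + y) ^+ 2 <= 2 * rnorm x ^+ 2 + 2 * rnorm y ^+ 2 *)
exists (2 * rnorm c ^+ 2 * M + 2 * N) => A.
apply: (@le_trans _ _ (\sum_(i <- A)
    (2 * rnorm c ^+ 2 * rnorm (u i) ^+ 2 + 2 * rnorm (v i) ^+ 2))).
  apply: ler_sum => i _.
  rewrite /= -[_ * _ * _]mulrA -exprMn -rnormZ.
  have := rnorm_sqrD ip_norm (c *: u i) (v i).
  have := rnorm_sqrB ip_norm (c *: u i) (v i).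
  have := sqr_ge0 (rnorm (c *: u i - v i)).
  by lra.
rewrite big_split /= -!mulr_sumr lerD ?ler_wpM2l//.
by rewrite mulr_ge0 ?sqr_ge0.
Qed.

Variables (A B : R).
Hypothesis A0 : 0 < A.
Hypothesis AB : A <= B.
Hypothesis frame : forall f : H,
  ((A * rnorm f ^+ 2)%:E <=
     \esum_(i in [set: I]) (w i ^+ 2 * rnorm (P i f) ^+ 2)%:E
   <= (B * rnorm f ^+ 2)%:E)%E.

Let B0 : 0 < B. Proof. exact: lt_le_trans AB. Qed.

Let analysis_ge0 f i : 0 <= w i ^+ 2 * rnorm (P i f) ^+ 2.
Proof. by rewrite mulr_ge0 ?sqr_ge0. Qed.

Lemma fusion_bessel x (E : {fset I}) :
  \sum_(i <- E) w i ^+ 2 * rnorm (P i x) ^+ 2 <= B * rnorm x ^+ 2.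
Proof. by have /andP[_ /esum_leP] := frame x; apply. Qed.

(** Pairing the partial sum [X] with itself turns each term into
    [w i * rdot (f i) (P i X)], which Bessel's inequality for [X] controls. *)
Lemma fusion_synthesis_bound (f : I -> H) (E : {fset I}) : (forall i, W i (f i)) ->
  rnorm (\sum_(i <- E) of_real k (w i) *: f i) ^+ 2
    <= B * \sum_(i <- E) rnorm (f i) ^+ 2.
Proof.
move=> Wf; set X := \sum_(i <- E) _.
have XE : 2 * B * rnorm X ^+ 2 <=
    B ^+ 2 * \sum_(i <- E) rnorm (f i) ^+ 2 + B * rnorm X ^+ 2.
  apply: le_trans (lerD (lexx _) (fusion_bessel X E)).
  rewrite -(rdotE ip_norm) {1}/X rdot_suml !mulr_sumr -big_split /=.
  apply: ler_sum => i _.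
  rewrite rdotZl (rdot_orth_proj ip_norm (clW i)) //.
  have := rnorm_sqrB ip_norm (of_real k B *: f i) (of_real k (w i) *: P i X).
  rewrite rdotZl rdotZr !rnormZ !exprMn !rnorm_of_real !real_normK ?num_real//.
  have := sqr_ge0 (rnorm (of_real k B *: f i - of_real k (w i) *: P i X)).
  lra.
by rewrite -(ler_pM2l B0); nra.
Qed.

Lemma fusion_synthesis_cvg (f : I -> H) : hilbert_sum W f ->
  sums_to (fun i => of_real k (w i) *: f i) (fusion_synthesis w f).
Proof.
move=> /hilbert_sumP[Wf [M fM]].
have [l fl] := sums_to_exists (fun i => sqr_ge0 (rnorm (f i))) (ltW B0) fM
  (fun E => fusion_synthesis_bound E Wf).
by rewrite /fusion_synthesis (sums_toE fl).
Qed.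

Definition fusion_analysis x : I -> H := fun i => of_real k (w i) *: P i x.

Lemma fusion_analysis_hilbert_sum x : hilbert_sum W (fusion_analysis x).
Proof.
apply/hilbert_sumP; split=> [i|].
  by apply: subspaceZ (subW i) _ _ _; exact: (orth_projP ip_norm (clW i) _).1.
exists (B * rnorm x ^+ 2) => E; apply: le_trans (fusion_bessel x E).
apply: ler_sum => i _; rewrite rnormZ exprMn rnorm_of_real.
by rewrite real_normK ?num_real.
Qed.

(** The operator S = T T^*, where the adjoint T^* of the synthesis operator is
    [fusion_analysis]. *)
Definition frame_operator x : H := fusion_synthesis w (fusion_analysis x).
Local Notation S := frame_operator.

Lemma frame_operator_cvg x :
  sums_to (fun i => of_real k (w i) *: fusion_analysis x i) (S x).
Proof. exact/fusion_synthesis_cvg/fusion_analysis_hilbert_sum. Qed.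

Lemma frame_operator_linear (c : K) x y : S (c *: x + y) = c *: S x + S y.
Proof.
apply: sums_toE; have := sums_to_linear c (frame_operator_cvg x) (frame_operator_cvg y).
congr (sums_to _ _); apply/funext => i; rewrite /fusion_analysis.
rewrite (orth_proj_linear ip_norm (clW i)) !scalerDr !scalerA.
by congr (_ *: _ + _); rewrite -mulrA [LHS]mulrC -mulrA.
Qed.

Lemma frame_operatorB x y : S (x - y) = S x - S y.
Proof. by rewrite addrC -scaleN1r frame_operator_linear scaleN1r addrC. Qed.

Lemma frame_operator_bound x : rnorm (S x) <= B * rnorm x.
Proof.
apply: sums_to_bound (frame_operator_cvg x) => E.
rewrite -(@ler_pXn2r _ 2) ?nnegrE ?mulr_ge0 ?rnorm_ge0 ?(ltW B0)//.
apply: le_trans (fusion_synthesis_bound E (fusion_analysis_hilbert_sum x).1) _.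
rewrite exprMn [B ^+ 2]expr2 -mulrA ler_pM2l//; apply: le_trans (fusion_bessel x E).
apply: ler_sum => i _; rewrite rnormZ exprMn rnorm_of_real.
by rewrite real_normK ?num_real.
Qed.

(** [rdot (S x) x] is the sum of the [w i ^+ 2 * rnorm (P i x) ^+ 2], which the
    lower frame bound estimates. *)
Lemma frame_operator_coercive x : A * rnorm x ^+ 2 <= rdot ip (S x) x.
Proof.
apply/ler_addgt0Pr => e e0; pose d := e / 2.
have d0 : 0 < d by rewrite divr_gt0.
have /andP[Ax _] := frame x; have [E1 E1P] := esum_adherent d0 Ax.
have x1 : 0 < rnorm x + 1 by rewrite ltr_wpDl ?rnorm_ge0.
have [|E2 E2P] := frame_operator_cvg x (e := d / (rnorm x + 1)).
  by rewrite divr_gt0.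
pose E := (E1 `|` E2)%fset; have := E2P E (fsubsetUr _ _).
have := fset_sumS (analysis_ge0 x) (fsubsetUl E1 E2); rewrite -/E.
set X := \sum_(i <- E) of_real k _ *: _.
have XE : rdot ip X x = \sum_(i <- E) w i ^+ 2 * rnorm (P i x) ^+ 2.
  rewrite rdot_suml; apply: eq_bigr => i _.
  by rewrite !rdotZl (rdot_orth_proj_self ip_norm (clW i)) mulrA expr2.
rewrite -XE => XE1; rewrite ltr_pdivlMr// => Xd.
have := rdot_le ip_norm (X - S x) x; rewrite rdotBl.
by have := rnorm_ge0 (X - S x); rewrite (splitr e) -/d; nra.
Qed.

Lemma frame_operator_expanding x : A * rnorm x <= rnorm (S x).
Proof.
have := frame_operator_coercive x; have := rdot_le ip_norm (S x) x.
have := rnorm_ge0 x; rewrite le_eqVlt => /predU1P[<- _ _|x0 h1 h2].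
  by rewrite mulr0 rnorm_ge0.
by rewrite -(ler_pM2r x0) -mulrA -expr2 (le_trans h2).
Qed.

(** Lax-Milgram: coercivity makes the range closed and leaves nothing
    orthogonal to it. *)
Lemma frame_operator_surjective y : exists x, S x = y.
Proof.
have subS : subspace (range S).
  split.
    by exists 0 => //; have := frame_operatorB 0 0; rewrite !subrr.
  move=> c _ _ [u _ <-] [v _ <-]; exists (c *: u + v) => //.
    by rewrite frame_operator_linear.
have clS : closed (range S).
  move=> z /closure_rnorm zS.
  have [l Dl] : exists l, forall e, 0 < e -> exists2 d, 0 < d &
      forall x, rnorm (S x - z) < d -> rnorm (x - l) < e.
    apply: (shrinking_limit (D := fun d => [set x | rnorm (S x - z) < d])).
    - by move=> d /zS[_ [x _ <-] xd]; exists x; rewrite /= rnormB.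
    - by move=> d e de x /= xd; exact: lt_le_trans de.
    - move=> e e0; exists (A * e / 2) => [|u v /= ud vd].
        by rewrite divr_gt0 ?mulr_gt0.
      rewrite -(ltr_pM2l A0); apply: le_lt_trans (frame_operator_expanding _) _.
      rewrite (rnormB _ z) in vd; rewrite frame_operatorB (splitr (A * e)).
      apply: le_lt_trans (ltrD ud vd); apply: le_trans (rnormD _ _).
      by rewrite addrA subrK.
  exists l => //; apply/eqP; rewrite -subr_eq0 -rnorm_eq0 eq_le rnorm_ge0 andbT.
  apply/ler_addgt0Pr => e e0; rewrite add0r.
  have [|d d0 dl] := Dl (e / 2 / B); first by rewrite !divr_gt0.
  have [|_ [x _ <-] xd] := zS (Num.min d (e / 2)).
    by rewrite lt_min d0 divr_gt0.
  move: xd; rewrite lt_min rnormB => /andP[/dl xl xe].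
  rewrite ltr_pdivlMr// in xl.
  have := frame_operator_bound (l - x); rewrite frame_operatorB (rnormB l).
  have := rnormD (S l - S x) (S x - z); rewrite addrA subrK.
  by rewrite (splitr e); move: xl xe; lra.
have [z [x _ xz] yz] := orthogonal_decomposition ip_norm y clS subS.
exists x; rewrite xz; apply/esym/eqP; rewrite -subr_eq0 -rnorm_eq0.
have := frame_operator_coercive (y - z).
rewrite rdotC /rdot yz; last by exists (y - z).
rewrite re_scalar0 pmulr_rle0// => h.
by rewrite -sqrf_eq0 eq_le h sqr_ge0.
Qed.

(** The synthesis operator has a bounded right inverse: the analysis of
    [S^-1 y]. *)
Lemma fusion_synthesis_preimage y : exists f : I -> H,
  [/\ hilbert_sum W f, fusion_synthesis w f = y &
      forall i, rnorm (f i) <= `|w i| * (rnorm y / A)].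
Proof.
have [x xy] := frame_operator_surjective y.
exists (fusion_analysis x); split=> // [|i]; first exact: fusion_analysis_hilbert_sum.
rewrite rnormZ rnorm_of_real ler_wpM2l//.
apply: le_trans (rnorm_orth_proj ip_norm (clW i) _) _.
by rewrite ler_pdivlMr// mulrC -xy frame_operator_expanding.
Qed.

End FrameOperator.

(** * Riesz bases *)

Section RieszBasis.
Variables (R : realType) (k : scalar_kind).
Local Notation K := (base_field R k).
Variables (H : completeNormedModType K) (ip : {dot H for @conj_scalar R k}).
Hypothesis ip_norm : forall x : H, ip x x = `|x| ^+ 2.
Variables (J : choiceType) (W : set H) (f : J -> H) (a b : R).
Hypothesis fR : riesz_basis W f a b.

Let a0 : 0 < a. Proof. by case: fR. Qed.
Let ab : a <= b. Proof. by case: fR. Qed.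
Let WE : closure (span_family [set: J] f) = W. Proof. by case: fR. Qed.

Let riesz_lower (A : {fset J}) (c : J -> K) :
  a * \sum_(j <- A) rnorm (c j) ^+ 2 <= rnorm (\sum_(j <- A) c j *: f j) ^+ 2.
Proof. by case: fR => _ _ _ /(_ A c) /andP[]. Qed.

Let riesz_upper (A : {fset J}) (c : J -> K) :
  rnorm (\sum_(j <- A) c j *: f j) ^+ 2 <= b * \sum_(j <- A) rnorm (c j) ^+ 2.
Proof. by case: fR => _ _ _ /(_ A c) /andP[]. Qed.

Lemma riesz_basis_mem j : W (f j).
Proof. by rewrite -WE; apply: subset_closure; exact: span_family_mem. Qed.

(** By the lower Riesz bound, [f j] is at distance at least [sqrt a] from every
    combination of the other vectors. *)
Lemma riesz_basis_isolated j : ~ closure (span_family (~` [set j]) f) (f j).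
Proof.
move=> /closure_rnorm /(_ (Num.sqrt a)); rewrite sqrtr_gt0 => /(_ a0)[_ [A [c [AD ->]]]].
have jA : j \notin A by apply/negP => /AD; exact.
apply/negP; rewrite -leNgt.
rewrite -(@ler_pXn2r _ 2) ?nnegrE ?rnorm_ge0 ?sqrtr_ge0// sqr_sqrtr ?(ltW a0)//.
have := riesz_lower (j |` A)%fset (fun i => if i == j then 1 else - c i).
rewrite !big_fsetU1//= eqxx scale1r -(of_real1 R k) rnorm_of_real normr1 expr1n.
have -> : \sum_(i <- A) (if i == j then of_real k 1 else - c i) *: f i
    = - \sum_(i <- A) c i *: f i.
  rewrite -sumrN; apply: eq_big_seq => i iA.
  by have [ij|_] := eqVneq i j; [rewrite -ij iA in jA|rewrite scaleNr].
apply: le_trans; rewrite -[leLHS]mulr1 ler_pM2l// lerDl.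
by apply: sumr_ge0 => i _; exact: sqr_ge0.
Qed.

(** [phi j] is the component of [f j] orthogonal to the closed span of the
    other vectors, rescaled. *)
Lemma riesz_biorthogonal :
  exists phi : J -> H, forall i j, ip (f i) (phi j) = (i == j)%:R.
Proof.
suff /choice[phi phiP] : forall j, exists y, forall i, ip (f i) y = (i == j)%:R.
  by exists phi.
move=> j; set M := span_family (~` [set j]) f.
have subM : subspace M by exact: span_subspace.
have [y My oy] := orthogonal_decomposition ip_norm (f j)
  (@closed_closure _ M) (closure_subspace subM).
pose g := f j - y.
have gM z : closure M z -> ip z g = 0 by move=> Mz; rewrite ipC oy// conj_scalar0.
have g0 : rnorm g ^+ 2 != 0.
  rewrite sqrf_eq0 rnorm_eq0 subr_eq0; apply/eqP => fjy.
  by apply: (@riesz_basis_isolated j); rewrite fjy.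
exists (of_real k (rnorm g ^+ 2)^-1 *: g) => i; rewrite ipZr conj_of_real.
have [->|ij] := eqVneq i j.
  rewrite -[f j](subrK y) -/g ipDl (gM _ My) addr0 ip_norm -of_real_rnorm.
  by rewrite [in X in _ * X]expr2 -!of_realM -expr2 mulVf// of_real1.
by rewrite gM ?mulr0//; apply: subset_closure; apply: span_family_mem => /eqP; exact/negP.
Qed.

Variable phi : J -> H.
Hypothesis phiP : forall i j, ip (f i) (phi j) = (i == j)%:R.

Lemma riesz_coord_lincomb (A : {fset J}) (c : J -> K) j :
  ip (\sum_(i <- A) c i *: f i) (phi j) = if j \in A then c j else 0.
Proof.
rewrite ip_suml; have [jA|jA] := boolP (j \in A).
  rewrite (big_fsetD1 j jA) /= ipZl phiP eqxx mulr1 big_seq big1 ?addr0// => i.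
  by rewrite !inE => /andP[/negPf ij _]; rewrite ipZl phiP ij mulr0.
rewrite big_seq big1// => i iA; rewrite ipZl phiP.
by have [ij|_] := eqVneq i j; [rewrite -ij iA in jA|rewrite mulr0].
Qed.

(** On the span this is the lower Riesz bound; both sides are continuous in [x]. *)
Lemma riesz_bessel x (A : {fset J}) : W x ->
  a * \sum_(j <- A) rnorm (ip x (phi j)) ^+ 2 <= rnorm x ^+ 2.
Proof.
rewrite -WE -subr_le0.
apply: (closure_le0 (F := fun x =>
  a * \sum_(j <- A) rnorm (ip x (phi j)) ^+ 2 - rnorm x ^+ 2)).
  have sqr_cont (F : H -> R) : continuous F -> continuous (fun x => F x ^+ 2).
    by move=> cF z; apply: (@continuousM _ _ F F); exact: cF.
  move=> z; apply: (@continuousB _ _ _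
    (fun x => a * \sum_(j <- A) _) (fun x => rnorm x ^+ 2)).
    apply: (@continuousM _ _ (fun=> a) (fun x => \sum_(j <- A) _)).
      exact: cst_continuous.
    apply: continuous_big; first exact: add_continuous.
    by move=> j _; apply: sqr_cont; exact: continuous_rnorm_ip.
  by apply: sqr_cont; exact: continuous_rnorm.
move=> _ [B [c [_ ->]]]; rewrite subr_le0 (widen_lincomb _ _ (fsubsetUl B A)).
apply: le_trans (riesz_lower _ _); rewrite ler_pM2l//.
apply: le_trans (fset_sumS _ (fsubsetUr B A)) => [|j]; last exact: sqr_ge0.
rewrite big_seq [leRHS]big_seq; apply: ler_sum => j jA.
by rewrite riesz_coord_lincomb inE jA orbT.
Qed.

(** In an approximation of [x] by a combination of the [f j], the terms where
    [x] has coordinate zero contribute, by Bessel's inequality, at most [b / a]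
    times the error of the approximation; they can be dropped. *)
Lemma riesz_expansion x : W x ->
  closure (span_family [set j | ip x (phi j) != 0] f) x.
Proof.
move=> Wx; apply/closure_rnorm => e e0; pose q := b / a.
have q1 : 1 <= q by rewrite ler_pdivlMr// mul1r.
have q0 : 0 < 1 + q by lra.
have /closure_rnorm /(_ (e / (1 + q))) [|s] :
    closure (span_family [set: J] f) x by rewrite WE.
  by rewrite divr_gt0.
move=> [A [d [_ sE]]]; rewrite ltr_pdivlMr// => xs.
have Ws : W s by rewrite -WE; apply: subset_closure; exists A, d.
have subW : subspace W by rewrite -WE; apply: closure_subspace; exact: span_subspace.
pose A1 := [fset j in A | ip x (phi j) != 0]%fset.
pose A2 := [fset j in A | ~~ (ip x (phi j) != 0)]%fset.
exists (\sum_(j <- A1) d j *: f j).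
  by exists A1, d; split=> // j /=; rewrite !inE => /andP[].
set s2 := \sum_(j <- A2) d j *: f j.
have -> : \sum_(j <- A1) d j *: f j = s - s2.
  by rewrite sE [in RHS](big_fsetID _ (fun j => ip x (phi j) != 0)) /= addrK.
have s2q : rnorm s2 <= q * rnorm (x - s).
  have qx : 0 <= q * rnorm (x - s) by apply: mulr_ge0; [lra|exact: rnorm_ge0].
  rewrite -(@ler_pXn2r _ 2) ?nnegrE ?rnorm_ge0//.
  apply: le_trans (riesz_upper _ _) _; rewrite exprMn.
  have Wxs : W (x - s) by exact: subspaceB.
  have := riesz_bessel A2 Wxs.
  have -> : \sum_(j <- A2) rnorm (ip (x - s) (phi j)) ^+ 2
      = \sum_(j <- A2) rnorm (d j) ^+ 2.
    apply: eq_big_seq => j; rewrite !inE negbK => /andP[jA /eqP xj].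
    by rewrite ipBl xj sub0r (@rnormN R k K) sE riesz_coord_lincomb jA.
  have -> : b = q * a by rewrite /q divfK// gt_eqF.
  rewrite -mulrA; set t := a * _ => th; have := sqr_ge0 (rnorm (x - s)).
  by move: th; nra.
rewrite opprB addrCA addrC; apply: le_lt_trans (rnormD _ _) _.
apply: le_lt_trans (lerD (lexx _) s2q) _.
by move: xs; rewrite mulrDr mulr1 mulrC [q * _]mulrC.
Qed.

Lemma riesz_coord_inj x : W x -> (forall j, ip x (phi j) = 0) -> x = 0.
Proof.
move=> /riesz_expansion /closure_rnorm xE x0.
apply/eqP; rewrite -rnorm_eq0 eq_le rnorm_ge0 andbT.
apply/ler_addgt0Pr => e /xE[_ [A [c [AD ->]]]].
by rewrite add0r big_seq big1 ?subr0 => [/ltW//|j /AD /=]; rewrite x0 eqxx.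
Qed.

End RieszBasis.

(** * Dimension and coordinate functionals *)

Section Coordinates.
Variables (K : fieldType) (U : lmodType K) (V : set U).
Hypothesis subV : subspace V.
Variables (T : choiceType) (c : T -> U -> K).
Hypothesis c_linear : forall e a u v, c e (a *: u + v) = a * c e u + c e v.
Implicit Types (E : {fset T}) (e : T) (u v : U).

Definition onto_coords E : Prop :=
  forall x : T -> K, exists2 u, V u & forall e, e \in E -> c e u = x e.

Let c0 e : c e 0 = 0.
Proof. by have := c_linear e (-1) 0 0; rewrite scaler0 addr0 mulN1r addNr. Qed.

Let cB e u v : c e (u - v) = c e u - c e v.
Proof. by rewrite addrC -scaleN1r c_linear mulN1r addrC. Qed.

Let c_sum e (I : Type) (s : seq I) (a : I -> K) (b : I -> U) :
  c e (\sum_(i <- s) a i *: b i) = \sum_(i <- s) a i * c e (b i).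
Proof.
elim: s => [|i s IHs]; first by rewrite !big_nil c0.
by rewrite !big_cons c_linear IHs.
Qed.

Lemma onto_coords_extend E e u : onto_coords E -> V u ->
  (forall e', e' \in E -> c e' u = 0) -> c e u != 0 -> onto_coords (e |` E)%fset.
Proof.
move=> ontoE Vu uE ue x; have [v Vv vE] := ontoE x.
exists (((x e - c e v) / c e u) *: u + v); first exact: subV.2.
move=> e'; rewrite !inE c_linear => /predU1P[->|e'E]; first by rewrite divfK ?subrK.
by rewrite (uE _ e'E) mulr0 add0r vE.
Qed.

Lemma onto_coords_dual E : onto_coords E ->
  exists b : T -> U, forall e,
    V (b e) /\ forall e', e' \in E -> c e' (b e) = (e' == e)%:R.
Proof.
move=> ontoE; suff /choice[b bP] : forall e, exists u,
  V u /\ forall e', e' \in E -> c e' u = (e' == e)%:R by exists b.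
by move=> e; have [u Vu uE] := ontoE (fun e' => (e' == e)%:R); exists u.
Qed.

Let sum_delta E (x : T -> K) e : e \in E ->
  \sum_(i <- E) x i * (e == i)%:R = x e.
Proof.
move=> eE; rewrite (big_fsetD1 e eE) /= eqxx mulr1 big_seq big1 ?addr0// => i.
by rewrite !inE eq_sym => /andP[/negPf -> _]; rewrite mulr0.
Qed.

(** With [b] dual to the coordinates on [E], subtracting from [u] its projection on
    the [b e] kills the coordinates on [E]. *)
Lemma onto_coords_residual E (b : T -> U) u :
    (forall e, V (b e) /\ forall e', e' \in E -> c e' (b e) = (e' == e)%:R) ->
    V u ->
  V (u - \sum_(e <- E) c e u *: b e) /\
  forall e, e \in E -> c e (u - \sum_(e <- E) c e u *: b e) = 0.
Proof.
move=> bP Vu; split.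
  apply: subspaceB => //; apply: subspace_sum => // e _.
  by apply: subspaceZ => //; exact: (bP e).1.
move=> e eE; rewrite cB c_sum; apply/eqP; rewrite subr_eq0 eq_sym; apply/eqP.
rewrite -[RHS](sum_delta (c^~ u) eE); apply: eq_bigr => i _.
by rewrite (bP i).2.
Qed.

(** Along an induction on [E], a new coordinate that vanishes on the common
    kernel of the previous ones is a combination of them. *)
Lemma onto_coords_or_relation E : onto_coords E \/
  exists2 x : T -> K, (exists2 e, e \in E & x e != 0) &
    forall u, V u -> \sum_(e <- E) x e * c e u = 0.
Proof.
elim/fset1U_rect: E => [|e E eE [ontoE|[x [e' e'E xe'] xV]]].
- by left=> x; exists 0; [exact: subV.1|].
- have [[u Vu [uE ue]]|noext] := pselect (exists2 u, V u &
      (forall e', e' \in E -> c e' u = 0) /\ c e u != 0).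
    by left; exact: onto_coords_extend ue.
  right; have [b bP] := onto_coords_dual ontoE.
  exists (fun e' => if e' == e then -1 else c e (b e')).
    by exists e; rewrite ?fset1U1// eqxx oppr_eq0 oner_eq0.
  move=> u Vu; rewrite big_fsetU1//= eqxx mulN1r.
  have [Vr rE] := onto_coords_residual bP Vu.
  have : c e (u - \sum_(e <- E) c e u *: b e) = 0.
    by apply: contrapT => /eqP ne; apply: noext; eexists; [exact: Vr|split].
  rewrite cB c_sum => /eqP; rewrite subr_eq0 => /eqP ->.
  apply/eqP; rewrite addrC subr_eq0; apply/eqP/eq_big_seq => i iE.
  by rewrite mulrC; case: eqP => // ie; rewrite -ie iE in eE.
- right; exists (fun e' => if e' == e then 0 else x e').
    exists e'; first by rewrite inE e'E orbT.
    by have [ee|//] := eqVneq e' e; rewrite -ee e'E in eE.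
  move=> u Vu; rewrite big_fsetU1//= eqxx mul0r add0r -[RHS](xV u Vu).
  by apply: eq_big_seq => i iE; case: eqP => // ie; rewrite -ie iE in eE.
Qed.

Lemma basis_of_injective_coords E : onto_coords E ->
    (forall u, V u -> (forall e, e \in E -> c e u = 0) -> u = 0) ->
  exists b : 'I_#|` E| -> U, is_basis V b.
Proof.
move=> ontoE injE; have [b bP] := onto_coords_dual ontoE.
pose t := tnth (in_tuple E).
have tE i : t i \in E by exact: mem_tnth.
have t_inj : injective t by apply/tuple_uniqP; exact: fset_uniq.
exists (b \o t); split.
  move=> x y xy; apply/rowP => i.
  suff coord z : c (t i) (lincomb (b \o t) z) = z 0 i by rewrite -[LHS]coord xy coord.
  rewrite /lincomb c_sum (bigD1 i)//= (bP (t i)).2// eqxx mulr1 big1 ?addr0// => j ji.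
  by rewrite (bP (t j)).2// (inj_eq t_inj) eq_sym (negPf ji) mulr0.
apply/seteqP; split=> [_ [x _ <-]|u Vu].
  by apply: subspace_sum => // i _; apply: subspaceZ => //; exact: (bP (t i)).1.
have [Vr rE] := onto_coords_residual bP Vu.
exists (\row_i c (t i) u) => //; rewrite -[RHS](subrK (\sum_(e <- E) c e u *: b e)).
rewrite (injE _ Vr rE) add0r big_tnth; apply: eq_bigr => i _.
by rewrite mxE.
Qed.

(** The matrix of the coordinates on [E] in the basis [b] has full row space. *)
Lemma card_onto_coords n (b : 'I_n -> U) E : is_basis V b -> onto_coords E ->
  (#|` E| <= n)%N.
Proof.
move=> [_ bV] ontoE; pose t := tnth (in_tuple E).
have t_inj : injective t by apply/tuple_uniqP; exact: fset_uniq.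
pose M := \matrix_(i < n, j < #|` E|) c (t j) (b i).
have : (1%:M <= M)%MS.
  apply/row_subP => j.
  have [u Vu uE] := ontoE (fun e => (e == t j)%:R).
  move: Vu; rewrite -bV => -[x _ xu]; suff -> : row j 1%:M = x *m M by exact: submxMl.
  apply/rowP => l; rewrite !mxE.
  have := uE (t l) (mem_tnth _ _); rewrite (inj_eq t_inj) eq_sym => <-.
  rewrite -xu /lincomb c_sum; apply: eq_bigr => i _.
  by rewrite mxE.
by move/mxrankS; rewrite mxrank1 => /leq_trans; apply; exact: rank_leq_row.
Qed.

Lemma basis_card_le m n (b : 'I_m -> U) (d : 'I_n -> U) :
  is_basis V b -> is_basis V d -> (m <= n)%N.
Proof.
move=> [b_inj bV] [_ dV].
have lin0 p (h : 'I_p -> U) : lincomb h 0 = 0.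
  by rewrite /lincomb big1// => i _; rewrite mxE scale0r.
have bd i : exists x, lincomb d x = b i.
  have : V (b i).
    rewrite -bV; exists (delta_mx 0 i) => //.
    rewrite /lincomb (bigD1 i)//= mxE !eqxx scale1r big1 ?addr0// => j ji.
    by rewrite mxE (negPf ji) andbF scale0r.
  by rewrite -dV => -[x _ xb]; exists x.
have [r rE] := choice bd.
pose N := \matrix_i r i.
suff /eqP <- : row_free N by exact: rank_leq_col.
apply: inj_row_free => v vN; apply: b_inj; rewrite lin0 -(lin0 _ d) -vN.
rewrite /lincomb.
under eq_bigr do rewrite -rE /lincomb scaler_sumr.
rewrite exchange_big; apply: eq_bigr => j _; rewrite mxE scaler_suml.
by apply: eq_bigr => i _; rewrite mxE scalerA.
Qed.

Variable R : realType.

(** A maximal set of independent coordinates is a coordinate system for [V], and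
    without a bound on such sets [V] has no finite basis. *)
Theorem dimension_coords :
    (forall u, V u -> (forall e, c e u = 0) -> u = 0) ->
  dimension R V = ereal_sup [set n%:R%:E |
    n in [set n : nat | exists E : {fset T}, #|` E|%fset = n /\ onto_coords E]].
Proof.
move=> sep; set S := (X in ereal_sup X).
have [[n nP]|unbounded] :=
    pselect (exists n, forall E, onto_coords E -> (#|` E| <= n)%N).
  pose p m := `[< exists2 E, #|` E| = m & onto_coords E >].
  have exp : exists m, p m.
    exists 0%N; apply/asboolP; exists fset0; rewrite ?cardfs0// => x.
    by exists 0; [exact: subV.1|].
  have ubp m : p m -> (m <= n)%N by move=> /asboolP[E <- /nP].
  case: (ex_maxnP exp ubp) => m /asboolP[E Em ontoE] m_max.
  have [b bV] : exists b : 'I_m -> U, is_basis V b.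
    rewrite -Em; apply: basis_of_injective_coords => // u Vu uE.
    apply: sep => // e; apply: contrapT => /eqP ue.
    have eE : e \notin E by apply: contra_neqN ue => /uE.
    have : p m.+1.
      apply/asboolP; exists (e |` E)%fset; first by rewrite cardfsU1 eE Em.
      exact: onto_coords_extend ue.
    by move/m_max; rewrite ltnn.
  have -> : dimension R V = m%:R%:E.
    apply: xget_unique; first by exists m => //; exists b.
    move=> _ [q [d dV] <-]; congr (_%:R%:E).
    by apply/eqP; rewrite eqn_leq (basis_card_le bV dV) (basis_card_le dV bV).
  apply/eqP; rewrite eq_le; apply/andP; split.
    by apply: ereal_sup_ubound; exists m => //; exists E.
  apply: ge_ereal_sup => _ [q [F [Fq ontoF]] <-].
  by rewrite lee_fin ler_nat; apply: m_max; apply/asboolP; exists F.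
have -> : dimension R V = +oo%E.
  apply: xgetPN => x [n [b bV] _]; apply: unbounded; exists n => E.
  exact: card_onto_coords bV.
apply/esym/eqP; rewrite -leye_eq leNgt; apply/negP => Soo.
apply: unbounded.
have S0 : (0%:E <= ereal_sup S)%E.
  apply: ereal_sup_ubound; exists 0%N => //; exists fset0; split; first exact: cardfs0.
  by move=> x; exists 0; [exact: subV.1|].
have /fineK SE : ereal_sup S \is a fin_num by rewrite ge0_fin_numE.
have s0 : 0 <= fine (ereal_sup S) by rewrite fine_ge0.
exists (Num.truncn (fine (ereal_sup S))) => E ontoE.
rewrite truncn_ge_nat//.
have : (#|` E|%:R%:E <= ereal_sup S)%E.
  by apply: ereal_sup_ubound; exists #|` E| => //; exists E.
by rewrite -SE lee_fin.
Qed.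

End Coordinates.

(** * Removable elements of the local frame *)

Section LocalFrame.
Variables (R : realType) (k : scalar_kind).
Local Notation K := (base_field R k).
Variables (H : completeNormedModType K) (ip : {dot H for @conj_scalar R k}).
Hypothesis ip_norm : forall x : H, ip x x = `|x| ^+ 2.
Variables (I : countType) (W : I -> set H) (w : I -> R).
Hypothesis WF : fusion_frame ip W w.
Variables (J : I -> countType) (f : forall i, J i -> H) (a b : I -> R).
Arguments f : clear implicits.
Hypothesis fR : forall i, riesz_basis (W i) (f i) (a i) (b i).
Variable phi : forall i, J i -> H.
Arguments phi : clear implicits.
Hypothesis phiP : forall i j j', ip (f i j) (phi i j') = (j == j')%:R.
Arguments phiP : clear implicits.

Local Notation T := {i : I & J i}.
Local Notation F := (local_frame w f).
Implicit Types (E : {fset T}) (e : T).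

Let clW i : closed_subspace (W i). Proof. by case: WF. Qed.
Let subW i : subspace (W i). Proof. exact: (closed_subspaceP (clW i)).2. Qed.
Let w0 i : of_real k (w i) != 0.
Proof. by rewrite of_real_eq0 gt_eqF//; case: WF. Qed.

Definition fusion_kernel : set (I -> H) :=
  [set u | hilbert_sum W u /\ fusion_synthesis w u = 0].

Definition local_coord e (u : I -> H) : K := ip (u (tag e)) (phi (tag e) (tagged e)).

Lemma local_coord_linear e (c : K) (u v : I -> H) :
  local_coord e (c *: u + v) = c * local_coord e u + local_coord e v.
Proof. by rewrite /local_coord ipDl ipZl. Qed.

Lemma local_coord_inj u : hilbert_sum W u -> (forall e, local_coord e u = 0) -> u = 0.
Proof.
move=> [Wu _] u0; apply/funext => i.
apply: (riesz_coord_inj ip_norm (fR i) (phiP i)) => // j.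
exact: (u0 (Tagged J j)).
Qed.

Lemma sums_to_fusion_synthesis (u : I -> H) : hilbert_sum W u ->
  sums_to (fun i => of_real k (w i) *: u i) (fusion_synthesis w u).
Proof.
by case: WF => cl _ [A [B [A0 AB fr]]]; exact: (fusion_synthesis_cvg ip_norm cl A0 AB fr).
Qed.

Lemma fusion_synthesis_linear (c : K) (u v : I -> H) :
    hilbert_sum W u -> hilbert_sum W v ->
  fusion_synthesis w (c *: u + v) = c *: fusion_synthesis w u + fusion_synthesis w v.
Proof.
move=> /sums_to_fusion_synthesis hu /sums_to_fusion_synthesis hv; apply: sums_toE.
have := sums_to_linear c hu hv; congr (sums_to _ _); apply/funext => i.
by rewrite /= scalerDr !scalerA [c * _]mulrC.
Qed.

Let subH : subspace (hilbert_sum W). Proof. exact: hilbert_sum_subspace. Qed.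

Lemma fusion_kernel_subspace : subspace fusion_kernel.
Proof.
split=> [|c u v [hu u0] [hv v0]].
  split; first exact: subH.1.
  have := fusion_synthesis_linear (-1) subH.1 subH.1.
  by rewrite scaler0 addr0 scaleN1r addNr.
by split; [exact: subH.2|rewrite fusion_synthesis_linear// u0 v0 scaler0 addr0].
Qed.

(** Only the basis vectors on which [x] has a nonzero coordinate matter, by
    [riesz_expansion]. *)
Lemma orthogonal_of_coords i x h : W i x ->
  (forall j, ip x (phi i j) != 0 -> ip (f i j) h = 0) -> ip x h = 0.
Proof.
move=> Wx xh.
apply: (closure_orthogonal ip_norm) (riesz_expansion ip_norm (fR i) (phiP i) Wx).
exact: span_orthogonal.
Qed.

(** [h] is then orthogonal to every [W i], against the lower frame bound. *)
Lemma orthogonal_local_frame h : (forall e, ip (f (tag e) (tagged e)) h = 0) -> h = 0.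
Proof.
move=> fh; case: WF => _ _ [A [_ [A0 _ /(_ h) /andP[Ah _]]]].
have P0 i : orth_proj ip (W i) h = 0.
  apply: (orth_proj0 ip_norm) => // x Wx; apply: (@orthogonal_of_coords i) => // j _.
  exact: (fh (Tagged J j)).
move: Ah; rewrite esum1 => [|i _]; last by rewrite P0 rnorm0 expr0n mulr0.
rewrite lee_fin pmulr_rle0// => h0; apply/eqP.
by rewrite -rnorm_eq0 -sqrf_eq0 eq_le h0 sqr_ge0.
Qed.

(** A vector [h] orthogonal to all [F e'] with [e'] outside [E] but not to
    [F e], and a kernel element [u] whose coordinates on [E] are those of the
    delta function at [e]: pairing the synthesis of [u] with [h] leaves the only
    term [ip (F e) h]. *)
Lemma complete_of_onto E : onto_coords fusion_kernel local_coord E ->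
  closure (span_family (~` [set` E]) F) = setT.
Proof.
move=> ontoE; apply: contrapT => nd.
have [h h0 hE] := orthogonal_of_not_dense ip_norm (span_subspace _ _) nd.
have fh i j : Tagged J j \notin E -> ip (f i j) h = 0.
  move=> ijE; have := hE _ (@span_family_mem _ _ _ _ F _ (Tagged J j) _).
  rewrite /local_frame ipZl => /(_ _)/eqP; rewrite mulf_eq0 (negPf (w0 _))/=.
  by move=> /(_ _)/eqP; apply => /= ?; move/negP: ijE.
have [[i0 j0] eE eh] : exists2 e, e \in E & ip (f (tag e) (tagged e)) h != 0.
  apply: contrapT => /forall2NP all0; move/eqP: h0; apply.
  apply: orthogonal_local_frame => -[i j].
  by have [/negP /fh //|/negP /negPn /eqP] := all0 (Tagged J j).
rewrite /= in eh; have [u [hu u0] uE] := ontoE (fun e => (e == Tagged J j0)%:R).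
have Wu i : W i (u i) := hu.1 i.
have uh i : i != i0 -> ip (u i) h = 0.
  move=> ii0; apply: orthogonal_of_coords (Wu i) _ => j uj; apply: fh.
  apply: contra_neqN uj => /uE; rewrite /local_coord /= => ->.
  by case: eqP => // /(congr1 (@tag _ _)) /= ii; rewrite ii eqxx in ii0.
have ui0h : ip (u i0) h = ip (f i0 j0) h.
  apply/eqP; rewrite -subr_eq0 -ipBl; apply/eqP.
  have Wf : W i0 (f i0 j0) := riesz_basis_mem (fR i0) j0.
  apply: (@orthogonal_of_coords i0) => [|j uj]; first exact: subspaceB.
  apply: fh; apply: contra_neqN uj => /uE; rewrite /local_coord /= ipBl phiP => ->.
  by rewrite eq_Tagged /= eq_sym subrr.
pose p := of_real k (w i0) * ip (f i0 j0) h.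
have p0 : 0 < rnorm p by rewrite lt_neqAle rnorm_ge0 eq_sym (@rnorm_eq0 R k K) mulf_neq0.
have h1 : 0 < rnorm h + 1 by rewrite ltr_wpDl ?rnorm_ge0.
have [|A0 A0P] := sums_to_fusion_synthesis hu (e := rnorm p / (rnorm h + 1)).
  by rewrite divr_gt0.
have := A0P _ (fsubsetUr [fset i0] A0)%fset; rewrite u0 subr0 ltr_pdivlMr//.
set X := \sum_(i <- _) _.
have -> : p = ip X h.
  rewrite ip_suml (big_fsetD1 i0) ?fset1U1//= ipZl ui0h big_seq big1 ?addr0// => i.
  by rewrite !inE => /andP[ii0 _]; rewrite ipZl uh// mulr0.
have := cauchy_schwarz ip_norm X h; have := rnorm_ge0 X.
by lra.
Qed.

(** The lift of [F e] to the direct sum: its coordinates are the delta function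
    at [e]. *)
Definition delta_family e : I -> H :=
  fun i => if i == tag e then f (tag e) (tagged e) else 0.

Lemma delta_family_hilbert_sum e : hilbert_sum W (delta_family e).
Proof.
apply/hilbert_sumP; split=> [i|]; rewrite /delta_family.
  by case: eqP => [->|_]; [exact: riesz_basis_mem (fR _) _|exact: (subW i).1].
exists (rnorm (f (tag e) (tagged e)) ^+ 2) => A.
apply: (@le_trans _ _ (\sum_(i <- (tag e |` A)%fset) rnorm (if i == tag e
    then f (tag e) (tagged e) else 0) ^+ 2)).
  by apply: fset_sumS => [i|]; [exact: sqr_ge0|exact: fsubsetU1].
rewrite (big_fsetD1 (tag e)) ?fset1U1//= eqxx big_seq big1 ?addr0// => i.
by rewrite !inE => /andP[/negPf -> _]; rewrite rnorm0 expr0n.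
Qed.

Lemma delta_family_synthesis e : fusion_synthesis w (delta_family e) = F e.
Proof.
apply: sums_toE => r r0; exists [fset tag e]%fset => A; rewrite fsub1set => eA.
rewrite (big_fsetD1 (tag e))//= /delta_family eqxx big_seq big1 ?addr0 => [|i].
  by rewrite /local_frame subrr rnorm0.
by rewrite !inE => /andP[/negPf -> _]; rewrite scaler0.
Qed.

Lemma delta_family_coord e e' : local_coord e' (delta_family e) = (e' == e)%:R.
Proof.
rewrite /local_coord /delta_family; case: e e' => [i j] [i' j'] /=.
have [ii|ii] := eqVneq i' i; last first.
  by rewrite ip0l; case: eqP => // /(congr1 (@tag _ _)) /= ij; rewrite ij eqxx in ii.
by subst i'; rewrite phiP eq_Tagged eq_sym.
Qed.

Lemma span_family_min (M : set H) (D : set T) : subspace M ->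
  (forall e, D e -> M (F e)) -> span_family D F `<=` M.
Proof.
move=> subM DM _ [A [c [AD ->]]]; apply: subspace_sum => // e eA.
by apply: subspaceZ => //; apply: DM; exact: AD.
Qed.

Lemma rnorm_sum (S : Type) (s : seq S) (x : S -> K) :
  rnorm (\sum_(i <- s) x i) <= \sum_(i <- s) rnorm (x i).
Proof.
elim: s => [|i s IHs]; first by rewrite !big_nil (@rnorm0 R k K).
by rewrite !big_cons (le_trans (@rnormD R k K _ _))// lerD.
Qed.

(** If the coordinates on [E] satisfied a relation [x] on the kernel, then
    completeness would give [F e0 = s + y] with [s] in the span of the remaining
    elements and [y] as small as wished. Lifting [y] to a small family [g], the
    kernel element [delta_family e0 - v - g], where [v] lifts [s], has coordinates on [E]
    close to those of [delta_family e0], so that [x e0] is arbitrarily small. *)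
Lemma onto_of_complete E : closure (span_family (~` [set` E]) F) = setT ->
  onto_coords fusion_kernel local_coord E.
Proof.
move=> compl.
have [//|[x [e0 e0E xe0] xV]] :=
  onto_coords_or_relation fusion_kernel_subspace local_coord_linear E.
exfalso; case: (WF) => cl _ [A [B [A0 AB fr]]].
pose lift := [set s | exists v, [/\ hilbert_sum W v, fusion_synthesis w v = s &
  forall e, e \in E -> local_coord e v = 0]].
have sub_lift : subspace lift.
  split=> [|c _ _ [u [hu <- uE]] [v [hv <- vE]]].
    have [h0 s0] := fusion_kernel_subspace.1.
    by exists 0; split=> // e _; rewrite /local_coord ip0l.
  exists (c *: u + v); split; first exact: subH.2.
    exact: fusion_synthesis_linear.
  by move=> e eE; rewrite local_coord_linear uE// vE// mulr0 addr0.
have span_lift : span_family (~` [set` E]) F `<=` lift.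
  apply: span_family_min => // e eE; exists (delta_family e); split.
  - exact: delta_family_hilbert_sum.
  - exact: delta_family_synthesis.
  - move=> e' e'E; rewrite delta_family_coord; case: eqP => // ee.
    by case: eE; rewrite /= -ee.
(* M rnorm y bounds the form x on the coordinates of any lift g of y given by the
   bounded right inverse. *)
pose M := \sum_(e <- E) rnorm (x e) * (`|w (tag e)| / A * rnorm (phi (tag e) (tagged e))).
have M0 : 0 <= M.
  apply: sumr_ge0 => e _; rewrite !mulr_ge0 ?rnorm_ge0 ?invr_ge0 ?(ltW A0)//.
have xe0_gt0 : 0 < rnorm (x e0).
  by rewrite lt_neqAle rnorm_ge0 eq_sym (@rnorm_eq0 R k K) xe0.
have : closure (span_family (~` [set` E]) F) (F e0) by rewrite compl.
move/closure_rnorm => /(_ (rnorm (x e0) / (M + 1))) [|s /span_lift [v [hv vs vE]]].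
  by rewrite divr_gt0// ltr_wpDl.
rewrite ltr_pdivlMr ?ltr_wpDl//; set y := F e0 - s => ysmall.
have [g [hg gy gb]] := fusion_synthesis_preimage ip_norm cl A0 AB fr y.
pose u := -1 *: v + (-1 *: g + delta_family e0).
have hd := delta_family_hilbert_sum e0.
have hgd : hilbert_sum W (-1 *: g + delta_family e0) by exact: subH.2.
have Vu : fusion_kernel u.
  split; first exact: subH.2.
  rewrite !fusion_synthesis_linear// delta_family_synthesis vs gy !scaleN1r /y.
  by rewrite opprB subrK addNr.
have := xV _ Vu.
have -> : \sum_(e <- E) x e * local_coord e u
    = x e0 - \sum_(e <- E) x e * local_coord e g.
  rewrite -[x e0](_ : \sum_(e <- E) x e * (e == e0)%:R = _) => [|]; last first.
    rewrite (big_fsetD1 e0)//= eqxx mulr1 big_seq big1 ?addr0// => e.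
    by rewrite !inE => /andP[/negPf -> _]; rewrite mulr0.
  rewrite -sumrB; apply: eq_big_seq => e eE.
  rewrite !local_coord_linear vE// delta_family_coord.
  by rewrite mulr0 add0r mulN1r mulrDr mulrN addrC.
move=> /eqP; rewrite subr_eq0 => /eqP xe0E.
suff : rnorm (x e0) <= M * rnorm y by have := rnorm_ge0 y; move: ysmall; nra.
rewrite xe0E (le_trans (rnorm_sum _ _))// /M mulr_suml; apply: ler_sum => e _.
rewrite (@rnormZ R k K) -mulrA ler_wpM2l ?rnorm_ge0//.
apply: le_trans (cauchy_schwarz ip_norm _ _) _.
rewrite mulrAC ler_wpM2r ?rnorm_ge0//; apply: le_trans (gb _) _.
by rewrite mulrA mulrAC.
Qed.

Lemma fusion_excess_local_frame : fusion_excess W w = frame_excess F.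
Proof.
rewrite /fusion_excess (dimension_coords fusion_kernel_subspace local_coord_linear R).
  congr ereal_sup; apply/seteqP; split=> _ [n [E [En EP]] <-]; exists n => //; exists E;
    split=> //; [exact: complete_of_onto|exact: onto_of_complete].
by move=> u [hu _]; exact: local_coord_inj.
Qed.

End LocalFrame.

Theorem proposition4 (R : realType) (k : scalar_kind)
    (H : completeNormedModType (base_field R k))
    (ip : {dot H for @conj_scalar R k})
    (ip_norm : forall x : H, ip x x = `|x| ^+ 2)
    (sepH : separable_space H)
    (I : countType) (W : I -> set H) (w : I -> R)
    (WF : fusion_frame ip W w)
    (J : I -> countType) (f : forall i, J i -> H) (a b : I -> R)
    (fR : forall i, riesz_basis (W i) (f i) (a i) (b i))
    (inf_a : (0%:E < ereal_inf (range (fun i => (a i)%:E)))%E)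
    (sup_b : (ereal_sup (range (fun i => (b i)%:E)) < +oo)%E) :
  fusion_excess W w = frame_excess (local_frame w f).
Proof.
pose phi i := projT1 (cid (riesz_biorthogonal ip_norm (fR i))).
apply: (fusion_excess_local_frame ip_norm WF fR (phi := phi)) => i.
exact: (projT2 (cid (riesz_biorthogonal ip_norm (fR i)))).
Qed.
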